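(* Let $G$ be an $H$-type Lie group with Lie algebra $\mathfrak{g}=\mathfrak{v}\dot{+}\mathfrak{z}$ and inner product $\langle\cdot,\cdot\rangle$ as in the context. Then for every $Y_{\mathfrak{z}}\in\mathfrak{z}\setminus\{0\}$ the equilibrium point $0+Y_{\mathfrak{z}}\in\mathfrak{v}\dot{+}\mathfrak{z}$ of the Lie-Poisson equation $\frac{dY_{\mathfrak{v}}}{dt}=j(Y_{\mathfrak{z}})Y_{\mathfrak{v}}$, $\frac{dY_{\mathfrak{z}}}{dt}=0$ (restricted to the coadjoint orbit through it) is Lyapunov stable.
   Context: $G$ is a Lie group whose real finite-dimensional Lie algebra $\mathfrak{g}$ is step-two nilpotent: $[\mathfrak{g},\mathfrak{g}]\subset\mathfrak{z}$, where $\mathfrak{z}$ is the centre. $\langle\cdot,\cdot\rangle$ is a positive-definite inner product on $\mathfrak{g}$, with restrictions $\langle\cdot,\cdot\rangle_{\mathfrak{z}}$, $\langle\cdot,\cdot\rangle_{\mathfrak{v}}$ to $\mathfrak{z}$ and to $\mathfrak{v}=\mathfrak{z}^{\perp}$. Write $Y=Y_{\mathfrak{v}}+Y_{\mathfrak{z}}$ according to $\mathfrak{g}=\mathfrak{v}\dot{+}\mathfrak{z}$. The $j$-mapping $j:\mathfrak{z}\to\mathrm{End}(\mathfrak{v})$ is defined by $\langle j(Z)V,V'\rangle_{\mathfrak{v}}=\langle Z,[V,V']\rangle_{\mathfrak{z}}$. $G$ is an $H$-type Lie group if $\langle j(Z)V,j(Z)V'\rangle_{\mathfrak{v}}=\langle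 Z,Z\rangle_{\mathfrak{z}}\langle V,V'\rangle_{\mathfrak{v}}$ for all $V,V'\in\mathfrak{v}$, $Z\in\mathfrak{z}$. Identify $\mathfrak{g}\cong\mathfrak{g}^*$ via $Y\mapsto\langle Y,\cdot\rangle$; the coadjoint orbit through $Y$ is $\{(\mathrm{Ad}_q)^{\mathrm{T}}Y:q\in G\}$, where $A^{\mathrm{T}}$ is the adjoint of $A$ for $\langle\cdot,\cdot\rangle$. The Lie-Poisson equation (the reduction of the geodesic flow of the left-invariant metric defined by $\langle\cdot,\cdot\rangle$) restricts to each coadjoint orbit. *)

(* Defs.v *)
From HB Require Import structures.
From mathcomp Require Import all_boot all_order all_algebra.
From mathcomp Require Import all_classical all_reals all_analysis.

Set Implicit Arguments.
Unset Strict Implicit.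
Unset Printing Implicit Defensive.
Import Order.TTheory GRing.Theory Num.Theory.
Import numFieldNormedType.Exports.

Local Open Scope classical_set_scope.
Local Open Scope ring_scope.

(* [U] is meant to be open. In finite dimension this is the usual C^k: once [f]
   is differentiable on [U], its partial derivatives have to be C^(k-1). *)
Fixpoint class_C (R : realType) (V W : normedModType R) (k : nat) (U : set V)
    (f : V -> W) : Prop :=
  match k with
  | 0 => forall x, U x -> {for x, continuous f}
  | k'.+1 => (forall x, U x -> differentiable f x) /\
             (forall v, class_C k' U ('D_v f))
  end.

Definition smooth_on (R : realType) (V W : normedModType R) (U : set V)
    (f : V -> W) : Prop :=
  forall k, class_C k U f.

(* A bare join: compatibility of the two structures is part of
   [lie_group_structure]. *)
#[short(type="groupTopologicalType")]
HB.structure Definition GroupTopological := {G of Group G & Topological G}.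

(* A smooth atlas of dimension [n] on [G] for which the group operations are
   smooth. [coord c] and [point c] are total functions, only meaningful on
   [dom c] and on [coord c @` dom c], between which they are mutually inverse
   homeomorphisms. *)
Record lie_group_structure (R : realType) (n : nat)
    (G : groupTopologicalType) := LieGroupStructure {
  chart : Type;
  dom : chart -> set G;
  coord : chart -> G -> 'rV[R]_n;
  point : chart -> 'rV[R]_n -> G;
  lie_hausdorff : hausdorff_space G;
  lie_second_countable : @second_countable G;
  dom_open : forall c, open (dom c);
  coord_dom_open : forall c, open (coord c @` dom c);
  dom_cover : forall q, exists c, dom c q;
  coordK : forall c q, dom c q -> point c (coord c q) = q;
  coord_continuous : forall c q, dom c q -> {for q, continuous (coord c)};
  point_continuous : forall c x, (coord c @` dom c) x ->
    {for x, continuous (point c)};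
  transition_smooth : forall c d,
    smooth_on [set x | (coord c @` dom c) x /\ dom d (point c x)]
      (fun x => coord d (point c x));
  mul_continuous : continuous (fun q : G * G => (q.1 * q.2)%g);
  mul_smooth : forall c1 c2 d,
    smooth_on [set x : 'rV[R]_n * 'rV[R]_n |
                [/\ (coord c1 @` dom c1) x.1, (coord c2 @` dom c2) x.2
                  & dom d (point c1 x.1 * point c2 x.2)%g]]
      (fun x => coord d (point c1 x.1 * point c2 x.2)%g);
  inv_continuous : continuous (fun q : G => q^-1%g);
  inv_smooth : forall c d,
    smooth_on [set x | (coord c @` dom c) x /\ dom d (point c x)^-1%g]
      (fun x => coord d (point c x)^-1%g)
}.

(* The tangent space at the identity is identified with ['rV_n] through a chart
   [c] around the identity. [Ad q] is the differential there of p |-> q p q^-1. *)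
Definition Ad (R : realType) (n : nat) (G : groupTopologicalType)
    (L : lie_group_structure R n G) (c : chart L) (q : G) (X : 'rV[R]_n)
    : 'rV[R]_n :=
  'd (fun x => coord c (q * point c x * q^-1)%g) (coord c 1%g) X.

(* The bracket of left-invariant vector fields, as the differential of the
   adjoint representation: [X, Y] = ad_X Y with ad = d(Ad)_1. *)
Definition tangent_bracket (R : realType) (n : nat) (G : groupTopologicalType)
    (L : lie_group_structure R n G) (c : chart L) (X Y : 'rV[R]_n)
    : 'rV[R]_n :=
  'd (fun x => Ad c (point c x) Y) (coord c 1%g) X.

Definition is_lie_bracket (R : realType) (g : lmodType R)
    (br : {bilinear g -> g -> g}) : Prop :=
  (forall X, br X X = 0) /\
  (forall X Y Z, br X (br Y Z) + br Y (br Z X) + br Z (br X Y) = 0).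

Definition lie_algebra_of (R : realType) (n : nat) (G : groupTopologicalType)
    (L : lie_group_structure R n G) (c : chart L)
    (br : {bilinear 'rV[R]_n -> 'rV[R]_n -> 'rV[R]_n}) : Prop :=
  [/\ dom c 1%g, is_lie_bracket br
    & forall X Y, br X Y = tangent_bracket c X Y].

Definition lie_center (R : realType) (g : lmodType R)
    (br : {bilinear g -> g -> g}) : set g :=
  [set Z | forall X, br Z X = 0].

Definition step_two (R : realType) (g : lmodType R)
    (br : {bilinear g -> g -> g}) : Prop :=
  forall X Y, lie_center br (br X Y).

(* {dot g for idfun}: symmetric positive-definite bilinear forms on g. *)
Definition center_perp (R : realType) (g : lmodType R)
    (br : {bilinear g -> g -> g}) (ip : {dot g for idfun}) : set g :=
  [set V | forall Z, lie_center br Z -> ip V Z = 0].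

(* This determines [j Z V] for Z in the centre and V in its complement; the
   other values of [j] are never used. *)
Definition is_j_map (R : realType) (g : lmodType R)
    (br : {bilinear g -> g -> g}) (ip : {dot g for idfun})
    (j : g -> g -> g) : Prop :=
  forall Z V, lie_center br Z -> center_perp br ip V ->
    center_perp br ip (j Z V) /\
    forall V', center_perp br ip V' -> ip (j Z V) V' = ip Z (br V V').

Definition H_type (R : realType) (g : lmodType R)
    (br : {bilinear g -> g -> g}) (ip : {dot g for idfun})
    (j : g -> g -> g) : Prop :=
  forall Z V V', lie_center br Z -> center_perp br ip V ->
    center_perp br ip V' -> ip (j Z V) (j Z V') = ip Z Z * ip V V'.

(* W = (Ad q)^T Y, written out as <W, X> = <Y, Ad q X> for all X. *)
Definition coadjoint_orbit (R : realType) (n : nat) (G : groupTopologicalType)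
    (L : lie_group_structure R n G) (c : chart L)
    (ip : {dot 'rV[R]_n for idfun}) (Y : 'rV[R]_n) : set 'rV[R]_n :=
  [set W | exists q : G, forall X, ip W X = ip Y (Ad c q X)].

(* [Y] solves dYv/dt = j(Yz) Yv, dYz/dt = 0 on the open interval ]a, b[. *)
Definition lie_poisson_solution (R : realType) (g : normedModType R)
    (br : {bilinear g -> g -> g}) (ip : {dot g for idfun})
    (j : g -> g -> g) (a b : R) (Y : R -> g) : Prop :=
  exists Yv Yz : R -> g, forall t, a < t < b ->
    [/\ center_perp br ip (Yv t), lie_center br (Yz t), Y t = Yv t + Yz t,
        is_derive t 1 Yv (j (Yz t) (Yv t)) & is_derive t 1 Yz 0].

(* Lyapunov stability of the equilibrium [p] for the restriction to the subset
   [M] (with the subspace topology) of the autonomous equation whose solutions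
   on ]a, b[ are given by [sol a b]. Quantifying over all bounded intervals
   around 0 covers all forward times. *)
Definition lyapunov_stable (R : realType) (E : topologicalType)
    (sol : R -> R -> (R -> E) -> Prop) (M : set E) (p : E) : Prop :=
  [/\ M p,
      forall a b, sol a b (cst p)
    & forall U, within M (nbhs p) U ->
        exists2 V, within M (nbhs p) V &
          forall (a b : R) (Y : R -> E), a < 0 < b ->
            sol a b Y -> (forall t, a < t < b -> M (Y t)) -> V (Y 0) ->
            forall t, 0 <= t < b -> U (Y t)].

(* Main.v *)
Require Import Defs.
From HB Require Import structures.
From mathcomp Require Import all_boot all_order all_algebra.
From mathcomp Require Import all_classical all_reals all_analysis.

Set Implicit Arguments.
Unset Strict Implicit.
Unset Printing Implicit Defensive.
Import Order.TTheory GRing.Theory Num.Theory.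
Import numFieldNormedType.Exports.

Local Open Scope classical_set_scope.
Local Open Scope ring_scope.

(** The squared distance
      q (Y) = <Y - p, Y - p>   to a central point p
    is a first integral of the Lie-Poisson flow: its derivative is
      2 <j(Yz) Yv, Yv + Yz - p>,
    where <j(Yz) Yv, Yv> = <Yz, [Yv, Yv]> = 0 because the bracket is
    alternating, and <j(Yz) Yv, Yz - p> = 0 because j(Yz) Yv is orthogonal to
    the centre ([lie_poisson_conserved]). A central p is an equilibrium, and a
    positive-definite first integral vanishing exactly at p is a Lyapunov
    function: its sublevel sets are invariant, they are neighbourhoods of p
    since q is continuous ([dot_sqr_continuous]), and they shrink to p since
    the inner product dominates the norm of the finite-dimensional space
    ([dot_coercive]). The sublevel sets are invariant in the whole Lie algebra,
    so intersecting them with the coadjoint orbit gives stability on the orbit.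

    That p lies on its own orbit is seen at the identity of the group, where Ad
    is the identity map ([Ad1]). *)

(** * Bilinear forms on finite-dimensional spaces *)

Lemma bilinear_rV_continuous (R : realType) (m n : nat)
    (B : {bilinear 'rV[R]_m -> 'rV[R]_n -> R}) :
  continuous (fun p : 'rV[R]_m * 'rV[R]_n => B p.1 p.2).
Proof.
have BE p : B p.1 p.2 = \sum_(i < m) \sum_(k < n)
    p.1 0 i * (p.2 0 k * B 'e_i 'e_k).
  rewrite [X in B X _]row_sum_delta linear_sumlz; apply: eq_bigr => i _.
  rewrite linearZl_LR [X in B _ X]row_sum_delta linear_sumr /= scaler_sumr.
  by apply: eq_bigr => k _; rewrite linearZr_LR.
rewrite (funext BE).
apply: continuous_big => [|i _]; first exact: add_continuous.
apply: continuous_big => [|k _]; first exact: add_continuous.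
move=> p; apply: cvgM.
  exact: (continuous_comp (@cvg_fst _ _ _ _ _) (@coord_continuous _ _ _ _ _ _)).
apply: cvgM; last exact: cvg_cst.
exact: (continuous_comp (@cvg_snd _ _ _ _ _) (@coord_continuous _ _ _ _ _ _)).
Qed.

Lemma is_derive_bilinear (R : realType) (U V W : normedModType R)
    (B : {bilinear U -> V -> W}) (f : R -> U) (g : R -> V) (df : U) (dg : V)
    (t : R) :
  continuous (fun p : U * V => B p.1 p.2) ->
  is_derive t 1 f df -> is_derive t 1 g dg ->
  is_derive t 1 (fun s => B (f s) (g s)) (B (f t) dg + B df (g t)).
Proof.
move=> Bc fdf gdg.
have fd : differentiable f t by apply/derivable1_diffP.
have gd : differentiable g t by apply/derivable1_diffP.
pose fg s := (f s, g s).
have fgd : differentiable fg t by exact: differentiable_pair.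
have Bd : differentiable (fun p : U * V => B p.1 p.2) (fg t).
  exact: differentiable_bilin.
have Bfgd : differentiable ((fun p : U * V => B p.1 p.2) \o fg) t.
  exact: differentiable_comp.
apply: DeriveDef; first exact/derivable1_diffP.
rewrite deriveE // (diff_comp fgd Bd) /= diff_bilin // diff_pair //=.
by rewrite -!deriveE // !derive_val.
Qed.

Lemma dot_sqr_continuous (R : realType) (n : nat)
    (ip : {dot 'rV[R]_n for idfun}) :
  continuous (fun x => ip x x).
Proof.
move=> x; apply: (@continuous_comp _ _ _ (fun x => (x, x))
  (fun p : 'rV[R]_n * 'rV[R]_n => ip p.1 p.2)).
  by apply: (@cvg_pair _ _ _ (nbhs x) (nbhs x) (nbhs x)); exact: cvg_id.
exact: (@bilinear_rV_continuous R n n ip).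
Qed.

(** An inner product dominates the squared norm because it attains a positive
    minimum on the unit sphere, which is compact; homogeneity extends the bound
    from the sphere to the whole space. *)
Lemma dot_coercive (R : realType) (n : nat) (ip : {dot 'rV[R]_n for idfun}) :
  exists2 m : R, 0 < m & forall x, m * `|x| ^+ 2 <= ip x x.
Proof.
pose S := [set x : 'rV[R]_n | `|x| = 1].
have Sin (x : 'rV[R]_n) : x != 0 -> S (`|x|^-1 *: x).
  by move=> x0; rewrite /S /= normrZ normfV normr_id mulVf // normr_eq0.
(* The sphere is empty exactly in dimension 0, where there is no minimum. *)
have [noS|/set0P S_neq0] := eqVneq S set0.
  exists 1 => // x; have [->|/Sin] := eqVneq x 0; last by rewrite noS.
  by rewrite normr0 expr0n mulr0 linear0l.
have S_compact : compact S.
  apply: bounded_closed_compact.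
    by exists 1; split=> // M M1 x /= ->; exact: ltW.
  apply: (@preimage_closed _ _ (@Num.norm R 'rV[R]_n) [set 1 : R]).
    by move=> x _; exact: norm_continuous.
  exact: closed_eq.
have qc := @dot_sqr_continuous R n ip.
have [x0 /set_mem Sx0 minx0] :=
  EVT_min_rV S_neq0 S_compact (continuous_subspaceT qc).
have x0_neq0 : x0 != 0 by rewrite -normr_eq0 Sx0 oner_eq0.
exists (ip x0 x0); first exact: neq0_dnorm_gt0.
move=> x; have [->|xn0] := eqVneq x 0.
  by rewrite normr0 expr0n mulr0 linear0l.
have := minx0 _ (mem_set (Sin x xn0)).
rewrite linearZl_LR linearZr_LR /= mulrA -expr2 exprVn mulrC ler_pdivlMr //.
by rewrite exprn_gt0 // normr_gt0.
Qed.

(** * The adjoint representation at the identity *)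

(** Read in the chart, conjugation by the identity is the identity map only
    near the base point, since [point c] is meaningful only on the open image of
    the chart. The differential depends only on these nearby values. *)
Lemma Ad1 (R : realType) (n : nat) (G : groupTopologicalType)
    (L : lie_group_structure R n G) (c : chart L) (X : 'rV[R]_n) :
  dom c 1%g -> Ad c 1%g X = X.
Proof.
move=> c1; rewrite /Ad.
set f := fun x => Defs.coord c (1 * Defs.point c x * 1^-1)%g.
set x0 := Defs.coord c 1%g.
have near_id : \forall x \near x0, f x = x.
  have : nbhs x0 (Defs.coord c @` dom c).
    by apply: open_nbhs_nbhs; split; [exact: coord_dom_open | exists 1%g].
  by apply: filterS => _ [q cq <-]; rewrite /f coordK // invg1 mul1g mulg1.
have fx0 : f x0 = x0 := nbhs_singleton near_id.
suff /(congr1 (@^~ X)) : 'd f x0 = idfun :> ('rV[R]_n -> 'rV[R]_n) by [].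
apply: diff_unique => [x|]; first exact: cvg_id.
apply/eqaddoP => e e0; move: near_id; rewrite (near_shift 0) => near_id.
apply: filterS near_id => h /=; rewrite subr0 !fctE /= => ->.
by rewrite fx0 [X in _ - X]addrC subrr normr0 mulr_ge0 // ltW.
Qed.

(** * Conservation along the Lie-Poisson flow *)

(** Solutions are only known on an open interval, so that constancy comes from
    the mean value theorem on the compact subintervals. *)
Lemma is_derive0_cst_within (R : realType) (f : R -> R) (a b : R) :
  (forall t, a < t < b -> is_derive t 1 f 0) ->
  forall s t, a < s -> s <= t -> t < b -> f t = f s.
Proof.
move=> df s t as_ st tb.
have dst u : s <= u <= t -> is_derive u 1 f 0.
  move=> /andP[su ut].
  by apply: df; rewrite (lt_le_trans as_ su) (le_lt_trans ut tb).
have [u||c _ /eqP] := @MVT_segment R f (cst 0) s t st.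
- by rewrite in_itv /= => /andP[su ut]; apply: dst; rewrite !ltW.
- apply: derivable_within_continuous => u; rewrite in_itv /= => su.
  by have [] := dst u su.
- by rewrite mul0r subr_eq0 => /eqP.
Qed.

(** The velocity j(Yz) Yv is orthogonal to Yv, as [Yv, Yv] = 0, and to the
    centre, which contains Yz - p: the derivative of the squared distance to p
    vanishes. *)
Lemma lie_poisson_conserved (R : realType) (n : nat)
    (br : {bilinear 'rV[R]_n -> 'rV[R]_n -> 'rV[R]_n})
    (ip : {dot 'rV[R]_n for idfun}) (j : 'rV[R]_n -> 'rV[R]_n -> 'rV[R]_n)
    (p : 'rV[R]_n) (a b : R) (Y : R -> 'rV[R]_n) :
  (forall X, br X X = 0) -> is_j_map br ip j -> lie_center br p ->
  lie_poisson_solution br ip j a b Y ->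
  forall s t, a < s -> s <= t -> t < b ->
    ip (Y t - p) (Y t - p) = ip (Y s - p) (Y s - p).
Proof.
move=> brXX jmap pz [Yv [Yz sol]].
apply: (is_derive0_cst_within (f := fun t => ip (Y t - p) (Y t - p))) => t atb.
have [Yvt Yzt _ dYv dYz] := sol t atb.
have [jperp jE] := jmap _ _ Yzt Yvt.
set W := j (Yz t) (Yv t) in dYv jperp jE.
have ipC x y : ip x y = ip y x by rewrite hermC expr0 mul1r.
have Wperp : ip W (Yv t + Yz t - p) = 0.
  rewrite linearBr linearDr /= jE // brXX linear0r.
  by rewrite (jperp _ Yzt) (jperp _ pz) addr0 subr0.
have dD : is_derive t 1 (fun s => Yv s + Yz s - p) W.
  have := is_deriveB (is_deriveD dYv dYz) (is_derive_cst p t 1).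
  by rewrite addr0 subr0.
have := is_derive_bilinear (@bilinear_rV_continuous R n n ip) dD dD.
rewrite /= [ip _ W]ipC Wperp addr0; apply: near_eq_is_derive.
have : \forall s \near t, s \in `]a, b[ by apply: near_in_itvoo; rewrite in_itv.
by apply: filterS => s; rewrite in_itv /= => /sol[_ _ ->].
Qed.

(** * Stability *)

Theorem corollary3p8 (R : realType) (n : nat) (G : groupTopologicalType)
    (L : lie_group_structure R n G) (c : chart L)
    (br : {bilinear 'rV[R]_n -> 'rV[R]_n -> 'rV[R]_n})
    (ip : {dot 'rV[R]_n for idfun}) (j : 'rV[R]_n -> 'rV[R]_n -> 'rV[R]_n) :
  lie_algebra_of c br ->
  step_two br ->
  is_j_map br ip j ->
  H_type br ip j ->
  forall Yz : 'rV[R]_n, lie_center br Yz -> Yz <> 0 ->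
    lyapunov_stable (lie_poisson_solution br ip j)
      (coadjoint_orbit c ip (0 + Yz)) (0 + Yz).
Proof.
move=> [c1 [brXX _] _] _ jmap htype Yz Yzz _; rewrite add0r.
have perp0 : center_perp br ip 0 by move=> Z _; exact: linear0l.
split.
- by exists 1%g => X; rewrite Ad1.
- move=> a b; exists (cst 0), (cst Yz) => t _.
  (* H-type gives |j(Yz) 0|^2 = |Yz|^2 * |0|^2 = 0. *)
  have -> : j (cst Yz t) (cst 0 t) = 0.
    apply/eqP/negPn/negP => /(@neq0_dnorm_gt0 _ _ _ ip).
    by rewrite htype // linear0l mulr0 ltxx.
  by split => //; [rewrite add0r | exact: is_derive_cst | exact: is_derive_cst].
move=> U MU; pose q (y : 'rV[R]_n) := ip (y - Yz) (y - Yz).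
(* The ball of radius e is sought inside U on the orbit; as m * |y|^2 <= <y, y>,
   it contains the sublevel set q < m * e^2. *)
have [m m_gt0 coercive] := dot_coercive ip.
move: MU => /nbhs_ballP[e /= e_gt0 ballU].
exists [set y | q y < m * e ^+ 2].
  have qc : q @ Yz --> q Yz.
    apply: (@continuous_comp _ _ _ (fun y : 'rV[R]_n => y - Yz)
      (fun x => ip x x) Yz).
      apply: (@continuousB _ _ _ id (cst Yz)); last exact: cst_continuous.
      by move=> ?.
    exact: dot_sqr_continuous.
  have : \forall y \near Yz, q y < m * e ^+ 2.
    apply: (cvgr_lt _ qc); rewrite {1}/q subrr linear0l.
    by rewrite mulr_gt0 ?exprn_gt0.
  by apply: filterS => y qy _.
move=> a b Y /andP[a0 b0] sol MY Y0 t /andP[t0 tb].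
apply: ballU; last by apply: MY; rewrite tb (lt_le_trans a0 t0).
have qt : q (Y t) < m * e ^+ 2.
  by rewrite /q (lie_poisson_conserved brXX jmap Yzz sol a0 t0 tb).
rewrite -ball_normE /= distrC -(@ltr_pXn2r _ 2) ?nnegrE ?normr_ge0 ?ltW //.
by rewrite -(ltr_pM2l m_gt0); apply: le_lt_trans qt; exact: coercive.
Qed.
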